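(* Let $k\ge2$ and consider the learned affine system under the controller $u(x)=Hx+W_{u\min}^{k+1}w^k+b_u^{k+1}$, i.e. the closed-loop system $$\dot x=(A+gH)x+W_{\min}w^k+b^{k+1}+gb_u^{k+1},\qquad W_{\min}=W^{k+1}+gW_{u\min}^{k+1},\quad W_{u\min}^{k+1}\in\underset{W_u^{k+1}}{\mathrm{argmin}}\,\|W^{k+1}+gW_u^{k+1}\|,$$ where $w^k=w^k(x)$ is the output of the $k$-th hidden layer of a feedforward network whose activation functions are incrementally sector bounded by $[K_1^i,K_2^i]$, $i=1,\dots,k$, and $b_u^{k+1}\in\mathbb{R}^l$ is arbitrary. Suppose there exist a positive definite matrix $P\in\mathbb{R}^{n\times n}$, positive constants $\underline{p},\overline{p},\gamma$, and a matrix $H\in\mathbb{R}^{l\times n}$ such that $\underline{p}I\le P\le\overline{p}I$ and $$U_1^\top\begin{bmatrix}(A+gH)^\top P+P(A+gH)+\gamma P & PW_{\min}\\ W_{\min}^\top P & 0\end{bmatrix}U_1+U_2^\top\begin{bmatrix}-2Q_1^\top Q_2 & Q_1^\top+Q_2^\top\\ Q_1+Q_2 & -2I\end{bmatrix}U_2\le0 .$$ Let $\mathcal{C}\subseteq\mathcal{D}$ be a set on which the closed-loop system with this $H$ is forward complete and forward invariant. Then the closed-loop system is contractive in $\mathcal{C}$.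
   Context: Network. $n=m_0=m_{k+1}$, $A\in\mathbb{R}^{n\times n}$, $g\in\mathbb{R}^{n\times l}$. For input $x\in\mathbb{R}^n$: $w^0=x$, $w^{i+1}=\phi^{i+1}(W^{i+1}w^i+b^{i+1})$ for $i=0,\dots,k-1$, with $W^{i+1}\in\mathbb{R}^{m_{i+1}\times m_i}$, $b^{i+1}\in\mathbb{R}^{m_{i+1}}$ for $i=0,\dots,k$. Each $\phi^i:\mathbb{R}^{m_i}\to\mathbb{R}^{m_i}$ acts componentwise through differentiable scalar activation functions $\varphi^i_j$, $j=1,\dots,m_i$. The uncontrolled learned model is $\dot x=Ax+W^{k+1}w^k+b^{k+1}$, with control entering as $gu(x)$. The minimization over $W_u^{k+1}\in\mathbb{R}^{l\times m_k}$ is with respect to an induced matrix norm. $\mathcal{D}\subseteq\mathbb{R}^n$ is a given set of states. Incremental sector bound $[K_1^i,K_2^i]$: $K_1^i=\mathrm{diag}(\alpha^i_1,\dots,\alpha^i_{m_i})$, $K_2^i=\mathrm{diag}(\beta^i_1,\dots,\beta^i_{m_i})$ with $\alpha^i_j\le\beta^i_j$ real, and $(\varphi^i_j(s)-\varphi^i_j(t)-\alpha^i_j(s-t))(\varphi^i_j(s)-\varphi^i_j(t)-\beta^i_j(s-t))\le0$ for all $s,t$ in the set of values of the $j$-th component of $W^iw^{i-1}+b^i$ as the network input $x$ ranges over $\mathcal{D}$. Matrices. $Q_1=\mathrm{blockdiag}(K_1^1W^1,\dots,K_1^kW^k)$, $Q_2=\mathrm{blockdiag}(K_2^1W^1,\dots,K_2^kW^k)$;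 $a=\sum_{i=1}^{k-1}m_i$; $$U_1=\begin{bmatrix}I_n&0_{n\times a}&0_{n\times m_k}\\0_{m_k\times n}&0_{m_k\times a}&I_{m_k}\end{bmatrix},\qquad U_2=\begin{bmatrix}I_n&0_{n\times a}&0_{n\times m_k}\\0_{a\times n}&I_a&0_{a\times m_k}\\0_{a\times n}&I_a&0_{a\times m_k}\\0_{m_k\times n}&0_{m_k\times a}&I_{m_k}\end{bmatrix}.$$ Forward complete and forward invariant on $\mathcal{C}$: for any initial state in $\mathcal{C}$ the trajectory exists and remains in $\mathcal{C}$ for all $t\ge0$. Contractive in a forward invariant set $\mathcal{C}$: there exist $c>0$, $\rho>0$ such that any two solutions with initial conditions in $\mathcal{C}$ satisfy $\|x_1(t)-x_2(t)\|\le ce^{-\rho t}\|x_1(0)-x_2(0)\|$ for all $t\ge0$ ($\|\cdot\|$ a fixed norm on $\mathbb{R}^n$). For symmetric matrices, $B\le C$ means $B-C$ is negative semidefinite. *)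

(* Defs.v *)
From HB Require Import structures.
From mathcomp Require Import all_boot all_order all_algebra.
From mathcomp Require Import all_classical all_reals all_analysis.
Set Implicit Arguments.
Unset Strict Implicit.
Unset Printing Implicit Defensive.
Import Order.TTheory GRing.Theory Num.Theory.
Import numFieldNormedType.Exports.
Local Open Scope classical_set_scope.
Local Open Scope ring_scope.

Section Norms.
Context {R : realType}.

(* Nonnegativity of [N] follows from these three axioms. *)
Definition is_norm (V : lmodType R) (N : V -> R) : Prop :=
  [/\ forall x y, N (x + y) <= N x + N y,
      forall a x, N (a *: x) = `|a| * N x &
      forall x, N x = 0 -> x = 0].

Definition induced_norm p q (Nin : 'cV[R]_q -> R) (Nout : 'cV[R]_p -> R)
    (M : 'M[R]_(p, q)) : R :=
  sup [set Nout (M *m v) | v in [set v | Nin v <= 1]].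

Definition argmin (T : Type) (f : T -> R) : set T :=
  [set x | forall y, f x <= f y].

End Norms.

Section Definiteness.
Context {R : realType}.

Definition posdef p (M : 'M[R]_p) : Prop :=
  M \is symmetricmx /\ forall v : 'cV_p, v != 0 -> 0 < (v^T *m M *m v) 0 0.

Definition negsemidef p (M : 'M[R]_p) : Prop :=
  M \is symmetricmx /\ forall v : 'cV_p, (v^T *m M *m v) 0 0 <= 0.

Definition loewner_le p (B C : 'M[R]_p) : Prop := negsemidef (B - C).

End Definiteness.

Section Flow.
Context {R : realType} {n : nat}.
Implicit Types (f : 'cV[R]_n -> 'cV[R]_n) (x : R -> 'cV[R]_n).

(* Only the restriction of [x] to [0, +oo[ is constrained: at time 0 the
   derivative is the right derivative. *)
Definition is_solution f x : Prop :=
  h^-1 *: (x h - x 0) @[h --> 0^'+] --> f (x 0) /\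
  forall t : R, 0 < t -> is_derive t 1 x (f (x t)).

Definition forward_complete f (C : set 'cV[R]_n) : Prop :=
  forall v, C v -> exists2 x, is_solution f x & x 0 = v.

Definition forward_invariant f (C : set 'cV[R]_n) : Prop :=
  forall x, is_solution f x -> C (x 0) -> forall t : R, 0 <= t -> C (x t).

Definition contractive (N : 'cV[R]_n -> R) f (C : set 'cV[R]_n) : Prop :=
  exists c rho : R, [/\ 0 < c, 0 < rho &
    forall x1 x2, is_solution f x1 -> is_solution f x2 ->
      C (x1 0) -> C (x2 0) ->
      forall t : R, 0 <= t ->
        N (x1 t - x2 t) <= c * expR (- rho * t) * N (x1 0 - x2 0)].

End Flow.

(* A family indexed by layers is shifted by one: [W i], [b i], [phi i] are
   W^{i+1}, b^{i+1}, varphi^{i+1}. The width of layer i is [m i], and the input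
   dimension is n = [m 0]. For a network with k hidden layers only the indices
   i < k are used. *)
Section Network.
Context {R : realType} (m : nat -> nat).
Variables (W : forall i, 'M[R]_(m i.+1, m i)) (b : forall i, 'cV[R]_(m i.+1)).
Variable phi : forall i, 'I_(m i.+1) -> R -> R.

Fixpoint layer (i : nat) (x : 'cV[R]_(m 0%N)) : 'cV[R]_(m i) :=
  match i with
  | 0 => x
  | i'.+1 => \col_j phi j ((W i' *m layer i' x + b i') j 0)
  end.

(* W^{i+1} w^i + b^{i+1} *)
Definition preactivation i (x : 'cV[R]_(m 0%N)) : 'cV[R]_(m i.+1) :=
  W i *m layer i x + b i.

Definition differentiable_activations (k : nat) : Prop :=
  forall i, (i < k)%N -> forall (j : 'I_(m i.+1)) s, derivable (phi j) s 1.

(* [alpha i] and [beta i] are the diagonals of K_1^{i+1} and K_2^{i+1}. *)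
Definition incremental_sector_bounded (k : nat) (D : set 'cV[R]_(m 0%N))
    (alpha beta : forall i, 'rV[R]_(m i.+1)) : Prop :=
  forall i, (i < k)%N -> forall j : 'I_(m i.+1),
    alpha i 0 j <= beta i 0 j /\
    forall s t, [set preactivation i x j 0 | x in D] s ->
                [set preactivation i x j 0 | x in D] t ->
      (phi j s - phi j t - alpha i 0 j * (s - t)) *
      (phi j s - phi j t - beta i 0 j * (s - t)) <= 0.

Section ClosedLoop.
Variables (l k : nat) (A : 'M[R]_(m 0%N)) (g : 'M[R]_(m 0%N, l)).
Variables (Wout : 'M[R]_(m 0%N, m k)) (bout : 'cV[R]_(m 0%N)).

Definition learned_field (x : 'cV[R]_(m 0%N)) : 'cV[R]_(m 0%N) :=
  A *m x + Wout *m layer k x + bout.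

Definition controller (H : 'M[R]_(l, m 0%N)) (Wu : 'M[R]_(l, m k))
    (bu : 'cV[R]_l) (x : 'cV[R]_(m 0%N)) : 'cV[R]_l :=
  H *m x + Wu *m layer k x + bu.

Definition closed_loop H Wu bu (x : 'cV[R]_(m 0%N)) : 'cV[R]_(m 0%N) :=
  learned_field x + g *m controller H Wu bu x.

Lemma closed_loopE H Wu bu x :
  closed_loop H Wu bu x =
  (A + g *m H) *m x + (Wout + g *m Wu) *m layer k x + bout + g *m bu.
Proof.
rewrite /closed_loop /learned_field /controller !mulmxDr !mulmxDl !mulmxA.
rewrite -!addrA; congr (_ + _).
by rewrite [RHS]addrCA; congr (_ + _); rewrite [LHS]addrCA; congr (_ + _);
   rewrite [LHS]addrCA.
Qed.

End ClosedLoop.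

End Network.

Section LMI.
Context {R : realType}.

(* a = m_1 + ... + m_{k-1} *)
Definition inner_width (m : nat -> nat) (k : nat) : nat :=
  (\sum_(1 <= i < k) m i)%N.

Lemma sum_out_widths (m : nat -> nat) k : (1 < k)%N ->
  (\sum_(i < k) m i.+1 = inner_width m k + m k)%N.
Proof.
case: k => // k _; rewrite /inner_width big_ord_recr /= big_add1 /=.
by rewrite big_mkord.
Qed.

Lemma sum_in_widths (m : nat -> nat) k : (1 < k)%N ->
  (\sum_(i < k) m i = m 0%N + inner_width m k)%N.
Proof.
case: k => // k _; rewrite /inner_width big_ord_recl big_add1 /=.
by rewrite big_mkord.
Qed.

(* Rectangular counterpart of [\mxdiag]; [conform_mx 0] only retypes the
   diagonal block [B i] along [i = j]. *)
Definition layer_blockdiag (m : nat -> nat) k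
    (B : forall i, 'M[R]_(m i.+1, m i)) :
    'M[R]_(\sum_(i < k) m i.+1, \sum_(i < k) m i) :=
  \mxblock_(i < k, j < k)
    (if i == j then conform_mx 0 (B i) else 0 : 'M[R]_(m i.+1, m j)).

(* blockdiag(K^1 W^1, ..., K^k W^k) where K^{i+1} = diag(kappa i) *)
Definition sector_blockdiag (m : nat -> nat) k (hk : (1 < k)%N)
    (W : forall i, 'M[R]_(m i.+1, m i)) (kappa : forall i, 'rV[R]_(m i.+1)) :
    'M[R]_(inner_width m k + m k, m 0%N + inner_width m k) :=
  castmx (sum_out_widths m hk, sum_in_widths m hk)
    (layer_blockdiag k (fun i => diag_mx (kappa i) *m W i)).

Definition U1 n a p : 'M[R]_(n + p, n + a + p) :=
  col_mx (row_mx (row_mx 1%:M 0) 0)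
         (row_mx (row_mx 0 0) 1%:M).

Definition U2 n a p : 'M[R]_((n + a) + (a + p), n + a + p) :=
  col_mx (col_mx (row_mx (row_mx 1%:M 0) 0)
                 (row_mx (row_mx 0 1%:M) 0))
         (col_mx (row_mx (row_mx 0 1%:M) 0)
                 (row_mx (row_mx 0 0) 1%:M)).

Definition lyapunov_block n p (Acl P : 'M[R]_n) (gamma : R)
    (Wmin : 'M[R]_(n, p)) : 'M[R]_(n + p) :=
  block_mx (Acl^T *m P + P *m Acl + gamma *: P) (P *m Wmin)
           (Wmin^T *m P) 0.

Definition sector_block p q (Q1 Q2 : 'M[R]_(p, q)) : 'M[R]_(q + p) :=
  block_mx (- 2 *: (Q1^T *m Q2)) (Q1^T + Q2^T)
           (Q1 + Q2) (- 2 *: 1%:M).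

Definition lmi_matrix n a p (Acl P : 'M[R]_n) (gamma : R)
    (Wmin : 'M[R]_(n, p)) (Q1 Q2 : 'M[R]_(a + p, n + a)) :
    'M[R]_(n + a + p) :=
  (U1 n a p)^T *m lyapunov_block Acl P gamma Wmin *m U1 n a p +
  (U2 n a p)^T *m sector_block Q1 Q2 *m U2 n a p.

End LMI.

(* Main.v *)
(* V(d) = d^T P d is a Lyapunov function for the difference d = x1 - x2 of two
   solutions in C. Evaluate the LMI at the vector of the layer differences
   (d^0, ..., d^k): its first term is dV/dt + gamma V, and its second term is
   -2 (y - Q1 z)^T (y - Q2 z) with z = (d^0, ..., d^(k-1)), y = (d^1, ..., d^k),
   which is nonnegative by the incremental sector bounds since C lies in D.
   Hence dV/dt <= - gamma V, and the bounds on P together with the equivalence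
   of norms give the rate gamma / 2 in any norm. *)
Require Import Defs.
From HB Require Import structures.
From mathcomp Require Import all_boot all_order all_algebra.
From mathcomp Require Import all_classical all_reals all_analysis.
From mathcomp Require Import ring lra.
Set Implicit Arguments.
Unset Strict Implicit.
Unset Printing Implicit Defensive.
Import Order.TTheory GRing.Theory Num.Theory.
Import numFieldNormedType.Exports.
Local Open Scope classical_set_scope.
Local Open Scope ring_scope.

(** * Stacked layer vectors and products with block-diagonal matrices *)

Section BlockColumns.
Context {R : realType}.

(** Only the natural-number value of the row index matters, so entries can be read even when
    [castmx] has left a cast ordinal as index. *)
Lemma mxcol_natE (w : nat -> nat) (F : forall i, 'cV[R]_(w i)) k i
    (j : 'I_(w i)) (r : 'I_(\sum_(i < k) w i)) :
  (i < k)%N -> r = (\sum_(i' < i) w i' + j)%N :> nat ->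
  (\mxcol_(i < k) F i) r 0 = F i j 0.
Proof.
move=> ik rE; pose r' := @tagnat.Rank k w (Ordinal ik) j.
have -> : r = r'.
  apply: val_inj; rewrite [RHS]tagnat.RankEsum /= rE (big_ord_widen k w) //.
  exact: ltnW.
by have /matrixP/(_ j 0) := mxcolK (fun i : 'I_k => F i) (Ordinal ik); rewrite mxE.
Qed.

Lemma sum_nat_rect (w : nat -> nat) k r : (r < \sum_(i < k) w i)%N ->
  exists i (j : 'I_(w i)), (i < k)%N /\ r = (\sum_(i' < i) w i' + j)%N.
Proof.
move=> rk; pose s := Ordinal rk.
exists (@tagnat.sig1 k w s), (@tagnat.sig2 k w s); split=> //.
have := @tagnat.rect k w s; rewrite /= => ->.
by congr (_ + _)%N; rewrite -(big_ord_widen k w) // ltnW.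
Qed.

(* The inputs of layers 1..k and the outputs of layers 1..k overlap in the
   outputs of layers 1..k-1, which U2 therefore duplicates. *)
Lemma stacked_blocks (m : nat -> nat) k (hk : (1 < k)%N)
    (F : forall i, 'cV[R]_(m i)) :
  exists s : 'cV[R]_(inner_width m k),
    castmx (sum_in_widths m hk, erefl) (\mxcol_(i < k) F i) =
      col_mx (F 0%N) s /\
    castmx (sum_out_widths m hk, erefl) (\mxcol_(i < k) F i.+1) =
      col_mx s (F k).
Proof.
(* The shared part [s] is what remains of the stacked inputs below the block [F 0]. *)
set z := castmx _ _; exists (dsubmx z).
have inE : inner_width m k = (\sum_(i < k.-1) m i.+1)%N.
  by rewrite /inner_width big_add1 big_mkord.
split; first rewrite -[LHS]vsubmxK; first congr col_mx.
  apply/colP => j; rewrite mxE /z castmxE cast_ord_id.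
  by apply: (@mxcol_natE m); [exact: ltnW | rewrite /= big_ord0].
rewrite -[LHS]vsubmxK; congr col_mx; apply/colP => j;
  rewrite !mxE !castmxE !cast_ord_id.
  have jlt : (j < \sum_(i < k.-1) m i.+1)%N by rewrite -inE.
  (* Block [i] of the outputs is block [i.+1] of the inputs; the leading block of height [m 0]
     accounts for the shift between the two positions. *)
  have [i [j' [ik jE]]] := sum_nat_rect (w := fun i => m i.+1) jlt.
  have ik' : (i.+1 < k)%N by rewrite -ltn_predRL.
  rewrite (@mxcol_natE (fun i => m i.+1) (fun i => F i.+1) _ _ j' _ (ltnW ik')) //.
  rewrite (@mxcol_natE m F _ _ j' _ ik') //.
  by rewrite /= big_ord_recl /= -addnA -jE.
case: k hk {z} inE j => // k hk inE j.
by apply: (@mxcol_natE (fun i => m i.+1) (fun i => F i.+1)); rewrite //= inE.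
Qed.

Lemma layer_blockdiag_mul (m : nat -> nat) k
    (B : forall i, 'M[R]_(m i.+1, m i)) (F : forall i, 'cV[R]_(m i)) :
  layer_blockdiag k B *m \mxcol_(i < k) F i = \mxcol_(i < k) (B i *m F i).
Proof.
rewrite mul_mxblock_mxrow; apply: eq_mxcol => i.
rewrite (bigD1 i)//= eqxx conform_mx_id big1 ?addr0// => j ji.
by rewrite eq_sym (negbTE ji) mul0mx.
Qed.

(** Here and in the next lemma the target dimensions are variables, so that the equalities can be
    eliminated; concrete sums of widths would block this. *)
Lemma dot_castmx p p' (e : p = p') (y z : 'cV[R]_p) :
  (castmx (e, erefl) y)^T *m castmx (e, erefl) z = y^T *m z.
Proof. by case: p' / e; rewrite !castmx_id. Qed.

Lemma castmx_residual p p' q q' (e1 : p = p') (e2 : q = q')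
    (y : 'cV[R]_p) (Q : 'M[R]_(p, q)) (z : 'cV[R]_q) :
  castmx (e1, erefl) y - castmx (e1, e2) Q *m castmx (e2, erefl) z =
  castmx (e1, erefl) (y - Q *m z).
Proof. by case: p' / e1; case: q' / e2; rewrite !castmx_id. Qed.

(** Links the matrix form of the sector condition to the scalar one: each summand is the sector
    product of a single neuron. *)
Lemma sector_residual_dot (m : nat -> nat) k (hk : (1 < k)%N)
    (W : forall i, 'M[R]_(m i.+1, m i)) (alpha beta : forall i, 'rV[R]_(m i.+1))
    (F : forall i, 'cV[R]_(m i)) :
  let y := castmx (sum_out_widths m hk, erefl) (\mxcol_(i < k) F i.+1) in
  let z := castmx (sum_in_widths m hk, erefl) (\mxcol_(i < k) F i) in
  ((y - sector_blockdiag hk W alpha *m z)^T *m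
   (y - sector_blockdiag hk W beta *m z)) 0 0 =
  \sum_(i < k) \sum_(j < m i.+1)
    (F i.+1 j 0 - alpha i 0 j * (W i *m F i) j 0) *
    (F i.+1 j 0 - beta i 0 j * (W i *m F i) j 0).
Proof.
move=> y z; rewrite !castmx_residual dot_castmx !layer_blockdiag_mul -!mxcolB.
rewrite tr_mxcol mul_mxrow_mxcol summxE; apply: eq_bigr => i _.
rewrite mxE; apply: eq_bigr => j _.
by rewrite -!mulmxA !mul_diag_mx !mxE.
Qed.

End BlockColumns.

(** * Quadratic forms behind the matrix inequality *)

Section QuadraticForms.
Context {R : realType}.

Lemma qform_congr p q (U : 'M[R]_(p, q)) (M : 'M[R]_p) (v : 'cV[R]_q) :
  v^T *m (U^T *m M *m U) *m v = (U *m v)^T *m M *m (U *m v).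
Proof. by rewrite trmx_mul !mulmxA. Qed.

Lemma trmx_11 (M : 'M[R]_1) : M^T = M.
Proof. by apply/matrixP => i j; rewrite mxE !ord1. Qed.

Lemma sector_qform p q (Q1 Q2 : 'M[R]_(p, q)) (z : 'cV[R]_q) (y : 'cV[R]_p) :
  (col_mx z y)^T *m sector_block Q1 Q2 *m col_mx z y =
  - 2 *: ((y - Q1 *m z)^T *m (y - Q2 *m z)).
Proof.
rewrite tr_col_mx /sector_block mul_row_block mul_row_col.
have -> : (y - Q1 *m z)^T = y^T - z^T *m Q1^T.
  by rewrite linearB/= trmx_mul.
rewrite !(mulmxBl, mulmxBr, mulmxDl, mulmxDr).
rewrite -!scalemxAr -!scalemxAl !mulmx1 !mulmxA.
(* A 1x1 product equals its transpose, which brings the cross terms to a common form. *)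
have -> : z^T *m Q1^T *m y = y^T *m Q1 *m z.
  by rewrite -[LHS]trmx_11 !trmx_mul !trmxK mulmxA.
have -> : z^T *m Q2^T *m y = y^T *m Q2 *m z.
  by rewrite -[LHS]trmx_11 !trmx_mul !trmxK mulmxA.
by apply/matrixP => i j; rewrite !mxE; ring.
Qed.

Lemma lyapunov_qform n p (Acl P : 'M[R]_n) (gamma : R) (Wm : 'M[R]_(n, p))
    (x : 'cV[R]_n) (y : 'cV[R]_p) :
  let f := Acl *m x + Wm *m y in
  (col_mx x y)^T *m lyapunov_block Acl P gamma Wm *m col_mx x y =
  f^T *m P *m x + x^T *m P *m f + gamma *: (x^T *m P *m x).
Proof.
move=> f; rewrite tr_col_mx /lyapunov_block mul_row_block mul_row_col.
have -> : f^T = x^T *m Acl^T + y^T *m Wm^T by rewrite linearD/= !trmx_mul.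
rewrite /f mulmx0 addr0.
rewrite !(mulmxDl, mulmxDr) !mulmxA -scalemxAr -scalemxAl.
by apply/matrixP => i j; rewrite !mxE; ring.
Qed.

Lemma U1_mul n a p (x : 'cV[R]_n) (s : 'cV[R]_a) (y : 'cV[R]_p) :
  U1 n a p *m col_mx (col_mx x s) y = col_mx x y.
Proof.
by rewrite mul_col_mx !mul_row_col !mul0mx !mul1mx !addr0 add0r.
Qed.

Lemma U2_mul n a p (x : 'cV[R]_n) (s : 'cV[R]_a) (y : 'cV[R]_p) :
  U2 n a p *m col_mx (col_mx x s) y = col_mx (col_mx x s) (col_mx s y).
Proof.
by rewrite !mul_col_mx !mul_row_col !mul0mx !mul1mx !addr0 !add0r.
Qed.

(** [U1] keeps the first and last blocks of [v], while [U2] duplicates the middle one, so each block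
    matrix sees exactly the pair of vectors it was built for. *)
Lemma lmi_qform n a p (Acl P : 'M[R]_n) (gamma : R) (Wm : 'M[R]_(n, p))
    (Q1 Q2 : 'M[R]_(a + p, n + a)) (x : 'cV_n) (s : 'cV_a) (y : 'cV_p) :
  let v := col_mx (col_mx x s) y in
  let f := Acl *m x + Wm *m y in
  v^T *m lmi_matrix Acl P gamma Wm Q1 Q2 *m v =
  f^T *m P *m x + x^T *m P *m f + gamma *: (x^T *m P *m x) -
  2 *: ((col_mx s y - Q1 *m col_mx x s)^T *m (col_mx s y - Q2 *m col_mx x s)).
Proof.
move=> v f; rewrite /lmi_matrix mulmxDr mulmxDl !qform_congr U1_mul U2_mul.
by rewrite lyapunov_qform sector_qform scaleNr.
Qed.

End QuadraticForms.

(** * Equivalence of an arbitrary norm with the max norm *)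

Section NormEquivalence.
Context {R : realType}.

Section NormTheory.
Context {V : lmodType R} {N : V -> R} (hN : is_norm N).

Lemma is_norm0 : N 0 = 0.
Proof. by case: hN => _ hZ _; rewrite -(scale0r 0) hZ normr0 mul0r. Qed.

Lemma is_normN x : N (- x) = N x.
Proof. by case: hN => _ hZ _; rewrite -scaleN1r hZ normrN1 mul1r. Qed.

Lemma is_norm_ge0 x : 0 <= N x.
Proof.
have [hD _ _] := hN; have := hD x (- x).
by rewrite subrr is_norm0 is_normN -mulr2n pmulrn_lge0.
Qed.

Lemma is_norm_sum (I : finType) (F : I -> V) :
  N (\sum_i F i) <= \sum_i N (F i).
Proof.
have [hD _ _] := hN.
elim/big_ind2 : _ => [|x1 x2 y1 y2 h1 h2|//]; first by rewrite is_norm0.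
exact: le_trans (hD _ _) (lerD _ _).
Qed.

End NormTheory.

Context {n : nat}.

Lemma le_coord_mx_norm p q (M : 'M[R]_(p, q)) i j : `|M i j| <= `|M|.
Proof.
rewrite [leRHS]/Num.norm/= mx_normrE.
exact: (le_bigmax _ (fun ij : 'I_p * 'I_q => `|M ij.1 ij.2|) (i, j)).
Qed.

Lemma is_norm_le_mx_norm (N : 'cV[R]_n -> R) : is_norm N ->
  exists2 c : R, 0 < c & forall x, N x <= c * `|x|.
Proof.
move=> hN; have [_ hZ _] := hN.
(* Expansion in the standard basis gives the sum; the added 1 keeps the constant positive when [n]
   is 0. *)
exists (1 + \sum_(i < n) N (delta_mx i 0)) => [|x].
  by rewrite ltr_pwDl// sumr_ge0// => i _; exact: is_norm_ge0.
rewrite {1}[x]matrix_sum_delta (eq_bigr (fun i => x i 0 *: delta_mx i 0)).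
  apply: le_trans (is_norm_sum hN _) _.
  rewrite mulrDl mul1r mulr_suml; apply: ler_wpDl => //; apply: ler_sum => i _.
  by rewrite hZ mulrC ler_wpM2l ?is_norm_ge0 ?le_coord_mx_norm.
by move=> i _; rewrite big_ord1.
Qed.

(** The norm is continuous, hence attains on the compact unit sphere of the max norm a minimum,
    positive by definiteness; homogeneity extends the bound to all vectors. *)
Lemma mx_norm_le_is_norm (N : 'cV[R]_n -> R) : is_norm N ->
  exists2 c : R, 0 < c & forall x : 'cV[R]_n, `|x| <= c * N x.
Proof.
move=> hN; have [hD hZ h0] := hN.
have [K K0 hK] := is_norm_le_mx_norm hN.
have trN p q (M : 'M[R]_(p, q)) : `|M^T| <= `|M|.
  rewrite [leLHS]/Num.norm/= mx_normrE.
  by apply: bigmax_le => // -[i j] _; rewrite mxE le_coord_mx_norm.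
(* The compactness argument runs on row vectors, and [trN] carries the max norm across
   transposition. *)
pose f (v : 'rV[R]_n) := N v^T.
pose S := [set v : 'rV[R]_n | `|v| = 1].
have cf : continuous f.
  move=> v; apply/(@cvgrPdist_le _ _ _ _ (nbhs_filter v)) => e e0; near=> w.
  have Nvw : `|f v - f w| <= N (v - w)^T.
    rewrite ler_norml; apply/andP; split.
      rewrite lerNl opprB lerBlDr /f.
      have := hD (w - v)^T v^T.
      by rewrite -linearD/= subrK -[(w - v)]opprB linearN/= is_normN.
    by rewrite lerBlDr /f; have := hD (v - w)^T w^T; rewrite -linearD/= subrK.
  apply: le_trans Nvw _; apply: le_trans (hK _) _.
  rewrite mulrC -ler_pdivlMr//; apply: le_trans (trN _ _ _) _.
  near: w; have /cvgrPdist_le : (id w @[w --> v] --> v) by exact: cvg_id.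
  by apply; rewrite divr_gt0.
have cS : compact S.
  apply: bounded_closed_compact.
    by exists 1; split => // r r1 v /= ->; exact: ltW.
  rewrite (_ : S = (fun v : 'rV[R]_n => `|v|) @^-1` [set 1]) //.
  apply: closed_comp; last exact: closed_eq.
  by move=> v _; exact: norm_continuous.
(* An empty sphere means that 0 is the only vector, and any positive constant serves. *)
have [[v0 Sv0]|S0] := pselect (S !=set0); last first.
  exists 1 => // x; rewrite mul1r.
  have [->|x0] := eqVneq x 0; first by rewrite normr0 is_norm_ge0.
  case: S0; exists (`|x^T|^-1 *: x^T); rewrite /S /= normrZ normfV normr_id.
  by rewrite mulVf// normr_eq0 trmx_eq0.
have [v Sv vmin] := @compact_EVT_min _ R f S (ex_intro _ v0 Sv0) cS
  (continuous_subspaceT cf).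
move: Sv; rewrite inE /S /= => v1.
have fv : 0 < f v.
  rewrite lt_neqAle eq_sym (is_norm_ge0 hN) andbT; apply/eqP => /h0/eqP.
  rewrite trmx_eq0 => /eqP v0'; move: v1; rewrite v0' normr0 => /eqP.
  by rewrite eq_sym oner_eq0.
exists (f v)^-1; first by rewrite invr_gt0.
move=> x; have [->|x0] := eqVneq x 0.
  by rewrite normr0 mulr_ge0 ?(is_norm_ge0 hN)// invr_ge0 ltW.
have xT0 : 0 < `|x^T| by rewrite normr_gt0 trmx_eq0.
have := vmin (`|x^T|^-1 *: x^T).
rewrite inE /S /= normrZ normfV normr_id mulVf ?gt_eqF// => /(_ erefl).
rewrite /f linearZ/= trmxK hZ normfV normr_id mulrC ler_pdivlMr// => h.
rewrite mulrC ler_pdivlMr// mulrC; apply: le_trans h.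
apply: ler_wpM2l; first exact: ltW.
by have := trN _ _ x^T; rewrite trmxK.
Unshelve. all: by end_near. Qed.

(** [|x|] is the max norm: its square is one of the squares summed in the dot product. *)
Lemma mx_norm_sqr_le_dot (x : 'cV[R]_n) : `|x| ^+ 2 <= (x^T *m x) 0 0.
Proof.
have dot_ge0 : 0 <= (x^T *m x) 0 0.
  by rewrite mxE sumr_ge0// => i _; rewrite mxE -expr2 sqr_ge0.
rewrite -[leRHS]sqr_sqrtr// ler_sqr ?nnegrE// ?sqrtr_ge0//.
rewrite [leLHS]/Num.norm/= mx_normrE; apply: bigmax_le => [|[i j] _ /=].
  exact: sqrtr_ge0.
rewrite (ord1 j) -sqrtr_sqr ler_wsqrtr// mxE (bigD1 i)//= mxE -expr2 lerDl.
by rewrite sumr_ge0// => k _; rewrite mxE -expr2 sqr_ge0.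
Qed.

Lemma dot_le_mx_norm_sqr (x : 'cV[R]_n) :
  (x^T *m x) 0 0 <= n%:R * `|x| ^+ 2.
Proof.
rewrite mxE -[n in n%:R]card_ord -sumr_const mulr_suml.
apply: ler_sum => i _; rewrite mxE mul1r -expr2 -real_normK ?num_real//.
by rewrite ler_sqr ?nnegrE// le_coord_mx_norm.
Qed.

End NormEquivalence.

(** * Exponential decay and derivatives along solutions *)

Section Decay.
Context {R : realType}.

(** Grönwall argument: with the integrating factor [expR (gamma * t)], the product with [V] has
    nonpositive derivative on the open half-line. Right continuity carries the monotonicity down to
    time 0. *)
Lemma exp_decay (V dV : R -> R) (gamma : R) :
  V h @[h --> 0^'+] --> V 0 ->
  (forall t : R, 0 < t -> is_derive t 1 V (dV t)) ->
  (forall t : R, 0 < t -> dV t <= - gamma * V t) ->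
  forall t : R, 0 <= t -> V t <= expR (- gamma * t) * V 0.
Proof.
move=> V0 V' V'le t t0.
pose E (s : R) := expR (gamma * s).
have E' (s : R) : is_derive (s : R) 1 E (gamma * E s).
  have : is_derive s 1 (expR \o ( *%R gamma)) (expR (gamma * s) * gamma).
    by apply: is_derive1_comp; rewrite -[X in is_derive _ _ _ X]mulr1;
      exact: is_deriveZ.
  by rewrite mulrC.
have G' (s : R) : 0 < s -> is_derive s 1 (E * V) (E s * (gamma * V s + dV s)).
  move=> s0; have := V' _ s0 => V's.
  apply: is_derive_eq; rewrite /GRing.scale/=; ring.
have : E t * V t <= E 0 * V 0.
  apply: (@ler0_derive1_nincry _ (E * V) 0) => //.
  - by move=> s; rewrite in_itv/= andbT => s0; have [] := G' _ s0.
  - move=> s; rewrite in_itv/= andbT => s0.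
    rewrite derive1E (@derive_val _ _ _ _ _ _ _ (G' _ s0)).
    rewrite pmulr_rle0 ?expR_gt0//.
    by have := V'le _ s0; lra.
  apply/continuous_within_itvcyP; split.
    move=> s; rewrite in_itv/= andbT => s0.
    by apply: differentiable_continuous; apply/derivable1_diffP; have [] := G' _ s0.
  apply: cvgM => //; apply: cvg_at_right_filter.
  by apply: differentiable_continuous; apply/derivable1_diffP; have [] := E' 0.
rewrite /E mulr0 expR0 mul1r => h.
by rewrite mulNr expRN mulrC ler_pdivlMr ?expR_gt0// mulrC.
Qed.

Lemma is_derive_coord p q (x : R -> 'M[R]_(p, q)) (t : R) d i j :
  is_derive t 1 x d -> is_derive t 1 (fun s => x s i j) (d i j).
Proof.
move=> [dx xd]; split; first by move/derivable_mxP : dx; apply.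
by rewrite -xd derive_mx// mxE.
Qed.

Context {n : nat}.

(** [x h] is [x 0] plus [h] times the difference quotient, and the quotient has a finite right
    limit. *)
Lemma solution_cvg0 (f : 'cV[R]_n -> 'cV[R]_n) x : is_solution f x ->
  x h @[h --> 0^'+] --> x 0.
Proof.
case=> x0 _.
have h0 : h @[h --> (0 : R)^'+] --> (0 : R).
  exact: (@cvg_at_right_filter R R id 0 0 (@cvg_id _ _)).
have F0 : Filter (0 : R)^'+ by exact: _.
have := @cvgD _ _ _ _ F0 _ _ _ _ (@cvgZ _ _ _ _ F0 _ _ _ _ h0 x0) (@cvg_cst _ (x 0) _ _ F0).
rewrite scale0r add0r => lim_x; refine (cvg_trans (near_eq_cvg _) lim_x).
near=> h.
have h_gt0 : 0 < h by near: h; exact: nbhs_right_gt.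
by rewrite addrfctE /= scalerA divff ?gt_eqF// scale1r subrK.
Unshelve. all: by end_near. Qed.

Lemma qformE (P : 'M[R]_n) (x : 'cV[R]_n) :
  (x^T *m P *m x) 0 0 = \sum_i \sum_j x j 0 * P j i * x i 0.
Proof.
rewrite mxE; apply: eq_bigr => i _; rewrite mxE mulr_suml.
by apply: eq_bigr => j _; rewrite mxE.
Qed.

Lemma is_derive_qform (P : 'M[R]_n) (x : R -> 'cV[R]_n) (t : R) d :
  is_derive t 1 x d ->
  is_derive t 1 (fun s => ((x s)^T *m P *m x s) 0 0)
    ((d^T *m P *m x t + (x t)^T *m P *m d) 0 0).
Proof.
move=> x'.
have c i : is_derive t 1 (fun s => x s i 0) (d i 0) by exact: is_derive_coord.
pose h i j : R -> R := (P j i \*: (fun s => x s j 0)) * (fun s => x s i 0).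
(* In coordinates the form is a finite sum of products of scalar functions, to which the scalar
   product rule applies. *)
rewrite (_ : (fun _ => _) = \sum_(i < n) \sum_(j < n) h i j).
  apply: is_derive_eq; rewrite !mxE -big_split/=; apply: eq_bigr => i _.
  rewrite !mxE !mulr_suml -big_split/=; apply: eq_bigr => j _.
  rewrite !mxE /GRing.scale/=; ring.
apply/funext => s; rewrite qformE fct_sumE; apply: eq_bigr => i _.
rewrite fct_sumE; apply: eq_bigr => j _.
by rewrite (mulrC (x s j 0)).
Qed.

Lemma cvg_qform (P : 'M[R]_n) (T : Type) (F : set_system T) (FF : Filter F)
    (x : T -> 'cV[R]_n) (v : 'cV[R]_n) : x @ F --> v ->
  ((x s)^T *m P *m x s) 0 0 @[s --> F] --> (v^T *m P *m v) 0 0.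
Proof.
move=> xv.
have c i : x s i 0 @[s --> F] --> v i 0.
  exact: (@cvg_comp _ _ _ x (fun M => M i 0) _ _ _ xv (@coord_continuous _ _ _ i 0 v)).
under eq_fun do rewrite qformE.
rewrite qformE; do 2 (apply: cvg_big => [|? _]; first exact: add_continuous).
by apply: cvgM => //; apply: cvgMl.
Qed.

End Decay.

(** * Decrease of the quadratic Lyapunov function *)

Section Contraction.
Context {R : realType} (m : nat -> nat).
Variables (W : forall i, 'M[R]_(m i.+1, m i)) (b : forall i, 'cV[R]_(m i.+1)).
Variable phi : forall i, 'I_(m i.+1) -> R -> R.

(** The biases cancel in the difference of preactivations, and both preactivations are values
    attained on [D], as the sector bound requires. *)
Lemma layer_sector (k : nat) (D : set 'cV[R]_(m 0%N))
    (alpha beta : forall i, 'rV[R]_(m i.+1)) :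
  incremental_sector_bounded W b phi k D alpha beta ->
  forall x1 x2, D x1 -> D x2 ->
  let d i := layer W b phi i x1 - layer W b phi i x2 in
  forall i (j : 'I_(m i.+1)), (i < k)%N ->
    (d i.+1 j 0 - alpha i 0 j * (W i *m d i) j 0) *
    (d i.+1 j 0 - beta i 0 j * (W i *m d i) j 0) <= 0.
Proof.
move=> hs x1 x2 D1 D2 d i j ik; have [_ h] := hs i ik j.
have preB : (W i *m d i) j 0 =
    preactivation W b phi i x1 j 0 - preactivation W b phi i x2 j 0.
  by rewrite /d mulmxBr /preactivation !mxE; ring.
have -> : d i.+1 j 0 = phi j (preactivation W b phi i x1 j 0) -
                       phi j (preactivation W b phi i x2 j 0).
  by rewrite /d /= !mxE.
by rewrite preB; apply: h; [exists x1 | exists x2].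
Qed.

Variables (l k : nat) (hk : (1 < k)%N).
Variables (A : 'M[R]_(m 0%N)) (g : 'M[R]_(m 0%N, l)).
Variables (Wout : 'M[R]_(m 0%N, m k)) (bout : 'cV[R]_(m 0%N)).
Variables (D : set 'cV[R]_(m 0%N)) (alpha beta : forall i, 'rV[R]_(m i.+1)).
Hypothesis hsector : incremental_sector_bounded W b phi k D alpha beta.
Variables (P : 'M[R]_(m 0%N)) (gamma : R) (H : 'M[R]_(l, m 0%N)).
Variables (Wu : 'M[R]_(l, m k)) (bu : 'cV[R]_l).
Hypothesis hLMI : loewner_le
  (lmi_matrix (A + g *m H) P gamma (Wout + g *m Wu)
     (sector_blockdiag hk W alpha) (sector_blockdiag hk W beta)) 0.
Let f := closed_loop W b phi A g Wout bout H Wu bu.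

Lemma lyapunov_decrease x1 x2 : D x1 -> D x2 ->
  (((f x1 - f x2)^T *m P *m (x1 - x2) +
    (x1 - x2)^T *m P *m (f x1 - f x2)) 0 0) <=
  - gamma * ((x1 - x2)^T *m P *m (x1 - x2)) 0 0.
Proof.
move=> D1 D2; set d := x1 - x2.
pose F i := layer W b phi i x1 - layer W b phi i x2.
have [s [zE yE]] := stacked_blocks hk F.
have [_ /(_ (col_mx (col_mx (F 0%N) s) (F k)))] := hLMI.
rewrite subr0 lmi_qform -zE -yE mxE [X in _ + X <= _]mxE.
rewrite [X in _ - X <= _]mxE sector_residual_dot.
(* The constant terms [bout] and [g *m bu] cancel in the difference. *)
have -> : (A + g *m H) *m F 0%N + (Wout + g *m Wu) *m F k = f x1 - f x2.
  rewrite /f !closed_loopE /F /= !mulmxBr.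
  by apply/matrixP => i j; rewrite !mxE; ring.
rewrite -[F 0%N]/d => lmi.
(* This sum enters [lmi] with factor -2, so its sign allows it to be dropped. *)
have slack : \sum_(i < k) \sum_(j < m i.+1)
    (F i.+1 j 0 - alpha i 0 j * (W i *m F i) j 0) *
    (F i.+1 j 0 - beta i 0 j * (W i *m F i) j 0) <= 0.
  apply: sumr_le0 => i _; apply: sumr_le0 => j _.
  exact: (layer_sector hsector D1 D2).
move: lmi; rewrite [X in X - _ <= _]mxE [X in _ + X - _ <= _]mxE => lmi.
lra.
Qed.

End Contraction.

(** * Contraction in an arbitrary norm *)

Theorem mainTheorem7 (R : realType) (k l : nat) (hk : (1 < k)%N)
  (m : nat -> nat)
  (A : 'M[R]_(m 0%N)) (g : 'M[R]_(m 0%N, l))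
  (W : forall i, 'M[R]_(m i.+1, m i)) (b : forall i, 'cV[R]_(m i.+1))
  (phi : forall i, 'I_(m i.+1) -> R -> R)
  (Wout : 'M[R]_(m 0%N, m k)) (bout : 'cV[R]_(m 0%N))
  (hphi : differentiable_activations phi k)
  (D : set 'cV[R]_(m 0%N))
  (alpha beta : forall i, 'rV[R]_(m i.+1))
  (hsector : incremental_sector_bounded W b phi k D alpha beta)
  (Nin : 'cV[R]_(m k) -> R) (hNin : is_norm Nin)
  (Nout : 'cV[R]_(m 0%N) -> R) (hNout : is_norm Nout)
  (Wumin : 'M[R]_(l, m k))
  (hWumin : argmin (fun Wu : 'M[R]_(l, m k) =>
                      induced_norm Nin Nout (Wout + g *m Wu)) Wumin)
  (bu : 'cV[R]_l)
  (P : 'M[R]_(m 0%N)) (plow pup gamma : R) (H : 'M[R]_(l, m 0%N))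
  (hP : posdef P) (hplow : 0 < plow) (hpup : 0 < pup) (hgamma : 0 < gamma)
  (hPlow : loewner_le (plow *: 1%:M) P) (hPup : loewner_le P (pup *: 1%:M))
  (hLMI : loewner_le
            (lmi_matrix (A + g *m H) P gamma (Wout + g *m Wumin)
               (sector_blockdiag hk W alpha) (sector_blockdiag hk W beta))
            0)
  (C : set 'cV[R]_(m 0%N)) (hCD : C `<=` D)
  (hcomplete :
     forward_complete (closed_loop W b phi A g Wout bout H Wumin bu) C)
  (hinvariant :
     forward_invariant (closed_loop W b phi A g Wout bout H Wumin bu) C)
  (N : 'cV[R]_(m 0%N) -> R) (hN : is_norm N) :
  contractive N (closed_loop W b phi A g Wout bout H Wumin bu) C.
Proof.
have [c1 c1_gt0 N_le] := is_norm_le_mx_norm hN.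
have [c2 c2_gt0 le_N] := mx_norm_le_is_norm hN.
have low (v : 'cV[R]_(m 0%N)) : plow * `|v| ^+ 2 <= (v^T *m P *m v) 0 0.
  have [_ /(_ v)] := hPlow.
  rewrite mulmxBr mulmxBl -scalemxAr mulmx1 -scalemxAl mxE [X in _ + X]mxE subr_le0.
  apply: le_trans; rewrite [leRHS]mxE ler_pM2l//.
  exact: mx_norm_sqr_le_dot.
(* The successor keeps the constant positive when the state space is trivial. *)
pose n1 : R := (m 0%N).+1%:R.
have up (v : 'cV[R]_(m 0%N)) : (v^T *m P *m v) 0 0 <= pup * n1 * `|v| ^+ 2.
  have [_ /(_ v)] := hPup.
  rewrite mulmxBr mulmxBl -scalemxAr mulmx1 -scalemxAl mxE [X in _ + X]mxE subr_le0.
  move=> /le_trans; apply; rewrite [leLHS]mxE -mulrA ler_pM2l//.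
  apply: le_trans (dot_le_mx_norm_sqr v) _.
  by rewrite ler_wpM2r ?sqr_ge0// ler_nat.
have n1_gt0 : 0 < n1 by rewrite ltr0n.
(* [K] is the distortion between the max norm and the square root of the form of [P], read off from
   [low] and [up]. *)
pose K := Num.sqrt (pup * n1 / plow).
have K2 : K ^+ 2 = pup * n1 / plow.
  by rewrite sqr_sqrtr// ltW// divr_gt0// mulr_gt0.
have K_gt0 : 0 < K by rewrite sqrtr_gt0 divr_gt0// mulr_gt0.
(* [c1] and [c2] pass between [N] and the max norm. The rate is halved because [V] is quadratic in
   the difference. *)
exists (c1 * K * c2), (gamma / 2); split; rewrite ?divr_gt0 ?mulr_gt0//.
move=> x1 x2 s1 s2 C1 C2 t t0.
pose d (s : R) := x1 s - x2 s.
pose V s := ((d s)^T *m P *m d s) 0 0.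
have Vt : V t <= expR (- gamma * t) * V 0.
  apply: (exp_decay (V := V)) t0.
  - apply: cvg_qform.
    exact: cvgB (solution_cvg0 s1) (solution_cvg0 s2).
  - move=> s s0; apply: is_derive_qform.
    by apply: is_deriveB; [apply: s1.2 | apply: s2.2].
  - move=> s s0; apply: (lyapunov_decrease bout hsector bu hLMI);
      by apply: hCD; apply: hinvariant => //; exact: ltW.
have dt : `|d t| <= expR (- (gamma / 2) * t) * K * `|d 0|.
  (* Squares are compared: [low] at time [t], the decay [Vt], and [up] at time 0 are chained after
     scaling by [plow]. *)
  rewrite -ler_sqr ?nnegrE ?mulr_ge0 ?expR_ge0 ?(ltW K_gt0)//.
  rewrite !exprMn K2 -expRM_natl.
  have -> : 2%:R * (- (gamma / 2) * t) = - gamma * t by field.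
  rewrite -(ler_pM2l hplow); apply: le_trans (low _) _; apply: le_trans Vt _.
  rewrite (_ : plow * _ = expR (- gamma * t) * (pup * n1 * `|d 0| ^+ 2)).
    by rewrite ler_pM2l ?expR_gt0// up.
  by field; rewrite gt_eqF.
apply: le_trans (N_le _) _.
have -> : c1 * K * c2 * expR (- (gamma / 2) * t) * N (x1 0 - x2 0) =
  c1 * (expR (- (gamma / 2) * t) * K * (c2 * N (x1 0 - x2 0))) by ring.
rewrite ler_pM2l//; apply: le_trans dt _.
by rewrite ler_pM2l ?mulr_gt0 ?expR_gt0// le_N.
Qed.
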